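(* For every integer $n \geq 3$, let $\Delta(n)$ denote the maximum of $\Delta(T)$ over all tournaments $T$ with $n$ vertices. Then $\Delta(n) = \left\lceil \frac{n+1}{2} \right\rceil$.
   Context: A tournament $T$ is a finite vertex set $V(T)$ with an arc set $A(T)$ such that for all distinct $x,y$, exactly one of $(x,y),(y,x)$ lies in $A(T)$. A module of $T$ is a subset $M \subseteq V(T)$ such that for all $x,y \in M$ and $v \notin M$, $(v,x)\in A(T)$ iff $(v,y)\in A(T)$; the trivial modules are $\emptyset$, singletons and $V(T)$. For $X \subseteq V(T)$ write $\overline{X} = V(T)\setminus X$. A co-module of $T$ is a subset $M \subseteq V(T)$ such that $M$ or $\overline{M}$ is a nontrivial module of $T$. A co-modular decomposition of $T$ is a set of pairwise disjoint co-modules of $T$. The co-modular index $\Delta(T)$ is the largest size of a co-modular decomposition of $T$. *)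

(* Defs.v *)
From mathcomp Require Import all_boot.

Set Implicit Arguments.
Unset Strict Implicit.
Unset Printing Implicit Defensive.

Record tournament := Tournament {
  vertex :> finType;
  arc : rel vertex;
  arc_irreflexive : irreflexive arc;
  arc_exactly_one : forall x y : vertex, x != y -> arc x y (+) arc y x
}.

Definition is_module (T : tournament) (M : {set T}) : bool :=
  [forall x in M, forall y in M, forall v in ~: M, arc v x == arc v y].

Definition trivial_set (T : tournament) (M : {set T}) : bool :=
  [|| M == set0, #|M| == 1 | M == [set: T]].

Definition nontrivial_module (T : tournament) (M : {set T}) : bool :=
  is_module M && ~~ trivial_set M.

Definition co_module (T : tournament) (M : {set T}) : bool :=
  nontrivial_module M || nontrivial_module (~: M).

Definition co_modular_decomposition (T : tournament) (D : {set {set T}}) : bool :=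
  [forall M in D, co_module M] && trivIset D.

Definition co_modular_index (T : tournament) : nat :=
  \max_(D : {set {set T}} | co_modular_decomposition D) #|D|.

(* Tournaments on n vertices form a proper class of finite types rather than a
   finite index set, so Delta(n) = m is expressed as "m is the greatest element
   of the set of values of the index". *)
Definition is_max_co_modular_index (n m : nat) : Prop :=
  (exists T : tournament, #|T| = n /\ co_modular_index T = m) /\
  (forall T : tournament, #|T| = n -> co_modular_index T <= m).

(* Main.v *)
From mathcomp Require Import all_boot.
From mathcomp Require Import zify.
Require Import Defs.

Set Implicit Arguments.
Unset Strict Implicit.
Unset Printing Implicit Defensive.

(** A singleton co-module is a source or a sink, and a tournament has at most
    one of each.  All other members of a co-modular decomposition [D] have at
    least two elements, so [2 #|D| <= n + 2].  The bound is attained by the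
    transitive tournament [0 < 1 < ... < n-1], cut into the intervals
    [{0}, {1, 2}, {3, 4}, ...] on which [uphalf] is constant: the complement of
    an extreme vertex is a module, and so is every interval. *)

Section UpperBound.
Variable T : tournament.
Implicit Types (M : {set T}) (D : {set {set T}}) (v : T).

Lemma is_moduleP M :
  reflect (forall x y v, x \in M -> y \in M -> v \notin M -> arc v x = arc v y)
          (is_module M).
Proof.
apply: (iffP forall_inP) => [mM x y v xM yM vM | mM x xM].
  have /forall_inP/(_ y yM)/forall_inP/(_ v) := mM x xM.
  by rewrite inE => /(_ vM)/eqP.
apply/forall_inP => y yM; apply/forall_inP => v; rewrite inE => vM.
by apply/eqP/mM.
Qed.

Lemma co_module_neq0 M : co_module M -> M != set0.
Proof.
apply: contraTneq => ->.
by rewrite /co_module /nontrivial_module /trivial_set setC0 !eqxx !orbT /= !andbF.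
Qed.

Definition is_source v := [forall x, (x != v) ==> arc v x].
Definition is_sink v := [forall x, (x != v) ==> ~~ arc v x].

(** A singleton is a trivial module, so the nontrivial module must be its complement; then all arcs
    between [v] and the other vertices point the same way. *)
Lemma co_module_set1 v : co_module [set v] -> is_source v || is_sink v.
Proof.
rewrite /co_module {1}/nontrivial_module /trivial_set cards1 eqxx orbT andbF /=.
case/andP=> /is_moduleP mv _.
have constv x y : x != v -> y != v -> arc v x = arc v y.
  by move=> xv yv; apply: mv; rewrite !inE ?eqxx.
apply/orP; have [[x /andP[xv vx]]|/existsPn no] :=
  altP (existsP (P := fun x => (x != v) && arc v x)).
  by left; apply/forallP => y; apply/implyP => yv; rewrite (constv y x).
right; apply/forallP => y; apply/implyP => yv.
by have := no y; rewrite yv.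
Qed.

Lemma card_source : #|[set v | is_source v]| <= 1.
Proof.
apply/card_le1_eqP => w v; rewrite !inE => /forallP sw /forallP sv.
apply/eqP; apply: contraT => nvw.
have := arc_exactly_one nvw.
by rewrite (implyP (sw v)) // (implyP (sv w)) // eq_sym.
Qed.

Lemma card_sink : #|[set v | is_sink v]| <= 1.
Proof.
apply/card_le1_eqP => w v; rewrite !inE => /forallP sw /forallP sv.
apply/eqP; apply: contraT => nvw.
have := arc_exactly_one nvw.
by rewrite (negbTE (implyP (sw v) _)) // (negbTE (implyP (sv w) _)) // eq_sym.
Qed.

Lemma card_co_module_set1 : #|[set v : T | co_module [set v]]| <= 2.
Proof.
apply: (leq_trans (subset_leq_card (B := [set v | is_source v] :|: [set v | is_sink v]) _)).
  by apply/subsetP => v; rewrite !inE; apply: co_module_set1.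
by rewrite (leq_trans (leq_card_setU _ _)) // (leq_add card_source card_sink).
Qed.

Lemma card_co_modular_decomposition D :
  co_modular_decomposition D -> #|D|.*2 <= #|T| + 2.
Proof.
case/andP=> /forall_inP coD /eqP trivD.
have card_singl : \sum_(M in D) (#|M| == 1) <= 2.
  apply: leq_trans card_co_module_set1.
  have -> : \sum_(M in D) (#|M| == 1) = #|[set M in D | #|M| == 1]|.
    by rewrite -sum1dep_card big_mkcondr; apply: eq_bigr => M _; case: eqP.
  rewrite -(card_imset _ (@set1_inj T)); apply: subset_leq_card.
  apply/subsetP => M; rewrite inE => /andP[MD /cards1P[v defM]].
  by apply/imsetP; exists v; rewrite // inE -defM coD.
(* Members are nonempty, so one extra unit for each singleton gives every member weight at least 2.
   Disjointness bounds the sum of the sizes by [#|T|], and [card_singl] bounds the extra units by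
   2. *)
apply: (@leq_trans (\sum_(M in D) (#|M| + (#|M| == 1)))).
  rewrite -mul2n mulnC -sum_nat_const; apply: leq_sum => M MD.
  by have := co_module_neq0 (coD M MD); rewrite -card_gt0; case: #|M| => [|[]].
by rewrite big_split leq_add //= trivD max_card.
Qed.

Lemma co_modular_index_le : co_modular_index T <= uphalf #|T|.+1.
Proof.
(* Half of [#|T| + 2], rounded down, equals [uphalf #|T|.+1]. *)
apply/bigmax_leqP => D /card_co_modular_decomposition; lia.
Qed.

Lemma nontrivial_set M x y z :
  x \in M -> y \in M -> x != y -> z \notin M -> ~~ trivial_set M.
Proof.
move=> xM yM nxy zM; rewrite /trivial_set !negb_or; apply/and3P; split.
- by apply/set0Pn; exists x.
- by rewrite gtn_eqF //; apply/card_gt1P; exists x, y.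
- by apply: contraNneq zM => ->; rewrite inE.
Qed.

End UpperBound.

Section TransitiveTournament.
Variable n : nat.

Definition ord_arc : rel 'I_n := fun i j => i < j.

Lemma ord_arc_irreflexive : irreflexive ord_arc.
Proof. by move=> i; rewrite /ord_arc ltnn. Qed.

Lemma ord_arc_exactly_one (i j : 'I_n) : i != j -> ord_arc i j (+) ord_arc j i.
Proof. by rewrite /ord_arc -val_eqE /=; case: ltngtP. Qed.

Definition transitive_tournament :=
  Tournament ord_arc_irreflexive ord_arc_exactly_one.

Implicit Types (M : {set transitive_tournament}).

(** A vertex outside a convex set lies below all of its elements or above all of them. *)
Lemma convex_is_module M :
  (forall i j k : 'I_n, i \in M -> k \in M -> i < j < k -> j \in M) -> is_module M.
Proof.
move=> convM; apply/is_moduleP => x y v xM yM vM.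
have ltNM (a b : 'I_n) : a \in M -> b \in M -> v < a -> v < b.
  move=> aM bM va; case: (ltngtP v b) => // [bv|/val_inj vb].
    by case/negP: vM; apply: (convM b v a); rewrite ?bv.
  by rewrite vb bM in vM.
by apply/idP/idP; apply: ltNM.
Qed.

Definition uphalf_block (k : nat) : {set transitive_tournament} :=
  [set i : 'I_n | uphalf i == k].

Hypothesis n_ge3 : 3 <= n.

Lemma co_module_uphalf_block k : k < uphalf n.+1 -> co_module (uphalf_block k).
Proof.
move=> kn; apply/orP.
have inord_lt m (mn : m < n) : exists i : 'I_n, i = m :> nat.
  by exists (Ordinal mn).
have [i0 i0E] : exists i : 'I_n, i = 0 :> nat by apply: inord_lt; lia.
have [i1 i1E] : exists i : 'I_n, i = 1 :> nat by apply: inord_lt; lia.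
have [i2 i2E] : exists i : 'I_n, i = 2 :> nat by apply: inord_lt; lia.
(* The block of index 0 is the source [{0}]; its complement is an interval containing 1 and 2, since
   [n >= 3]. *)
have [k0|k_gt0] := posnP k.
  right; apply/andP; split.
    by apply: convex_is_module => i j l; rewrite !inE; lia.
  by apply: (@nontrivial_set transitive_tournament _ i1 i2 i0); rewrite ?inE -?val_eqE /=; lia.
(* For [0 < 2k < n] the block is the full pair [{2k-1, 2k}], an interval that misses 0. *)
have [kn2|nk2] := ltnP k.*2 n.
  have [i iE] : exists i : 'I_n, i = k.*2 :> nat by apply: inord_lt; lia.
  have [j jE] : exists i : 'I_n, i = k.*2.-1 :> nat by apply: inord_lt; lia.
  left; apply/andP; split.
    by apply: convex_is_module => a b c; rewrite !inE; lia.
  by apply: (@nontrivial_set transitive_tournament _ i j i0); rewrite ?inE -?val_eqE /=; lia.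
(* Now [k < uphalf n.+1] forces [2k = n]: the pair is cut off to the sink [{n-1}]. Its complement is
   an initial interval, containing 0 and 1 because [n >= 3]. *)
have [i iE] : exists i : 'I_n, i = n.-1 :> nat by apply: inord_lt; lia.
right; apply/andP; split.
  apply: convex_is_module => a b c; rewrite !inE.
  by have := ltn_ord c; lia.
by apply: (@nontrivial_set transitive_tournament _ i0 i1 i); rewrite ?inE -?val_eqE /=; lia.
Qed.

Definition uphalf_blocks : {set {set transitive_tournament}} :=
  [set uphalf_block k | k : 'I_(uphalf n.+1)].

Lemma co_modular_uphalf_blocks : co_modular_decomposition uphalf_blocks.
Proof.
apply/andP; split.
  by apply/forall_inP => _ /imsetP[k _ ->]; apply: co_module_uphalf_block.
apply/trivIsetP => _ _ /imsetP[k _ ->] /imsetP[l _ ->] neq_kl.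
rewrite -setI_eq0; apply: contraNT neq_kl => /set0Pn[i].
by rewrite !inE => /andP[/eqP-> /eqP->].
Qed.

(** Blocks are nonempty, being co-modules, and any element [i] of a block recovers its index as
    [uphalf i]; hence no two indices give the same block. *)
Lemma card_uphalf_blocks : #|uphalf_blocks| = uphalf n.+1.
Proof.
rewrite card_imset ?card_ord // => k l eq_kl; apply: val_inj => /=.
have /set0Pn[i ik] := co_module_neq0 (co_module_uphalf_block (ltn_ord k)).
have := ik; rewrite eq_kl; move: ik.
by rewrite !inE => /eqP-> /eqP.
Qed.

Lemma co_modular_index_transitive :
  co_modular_index transitive_tournament = uphalf n.+1.
Proof.
apply/eqP; rewrite eqn_leq; apply/andP; split.
  by have := co_modular_index_le transitive_tournament; rewrite card_ord.
rewrite -card_uphalf_blocks.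
exact: (bigmax_sup _ co_modular_uphalf_blocks).
Qed.

End TransitiveTournament.

(* uphalf k is the ceiling of k / 2. *)
Theorem theorem3 (n : nat) (hn : 3 <= n) :
  is_max_co_modular_index n (uphalf n.+1).
Proof.
split; last by move=> T <-; apply: co_modular_index_le.
exists (transitive_tournament n); split; first by rewrite card_ord.
exact: co_modular_index_transitive.
Qed.
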